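(* Let $q \in \mathbb{R}$ and let $A$ and $B$ be $n\times n$ complex matrices. If $A$ is a normal matrix or $n=2$, then the inequality $$f(A,B;q) \le c(q)\, \|A\|^2 \|B\|^2$$ holds, where $$c(q) = \frac{(1+q) + \sqrt{2(1+q^2)}}{2}.$$ Moreover, this inequality is sharp, i.e., there are non-zero matrices $A$ and $B$ at which the bound is attained.
   Context: $M_n(\mathbb{C})$ denotes the $n\times n$ complex matrices and $A^*$ the conjugate transpose of $A$. The Hilbert-Schmidt inner product is $\langle A, B\rangle = \operatorname{tr}(A^*B)$ and $\|A\| = \sqrt{\operatorname{tr}(A^*A)}$ is the Frobenius norm. The commutator is $[A,B] = AB - BA$, and for $q \in \mathbb{R}$ the $q$-deformed commutator is $[A,B]_q = AB - qBA$. For $A,B\in M_n(\mathbb{C})$ and $q\in\mathbb{R}$ define $$f(A,B;q) := \operatorname{Re}\langle [B,A], [B,A]_q\rangle = \operatorname{tr}\left(A^*B^*BA + q\,B^*A^*AB - \tfrac{1+q}{2}\left(A^*B^*AB + B^*A^*BA\right)\right).$$ *)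

(* Defs.v *)
From HB Require Import structures.
From mathcomp Require Import ring.
From mathcomp Require Export all_boot all_order all_algebra.
From mathcomp Require Export reals complex.

Set Implicit Arguments.
Unset Strict Implicit.
Unset Printing Implicit Defensive.
Import Order.TTheory GRing.Theory Num.Theory.
Local Open Scope ring_scope.
Local Open Scope complex_scope.
Local Open Scope sesquilinear_scope.

(* Conjugate-linear in the first argument; A ^t* is the conjugate transpose. *)
Definition hs_inner (R : realType) (n : nat) (A B : 'M[R[i]]_n) : R[i] :=
  \tr (A ^t* *m B).

(* tr(A^*A) is a nonnegative element of R[i]; taking its real part only changes
   its type to R. *)
Definition frob_norm (R : realType) (n : nat) (A : 'M[R[i]]_n) : R :=
  Num.sqrt (complex.Re (\tr (A ^t* *m A))).

Definition commutator (R : realType) (n : nat) (A B : 'M[R[i]]_n) : 'M[R[i]]_n :=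
  A *m B - B *m A.

Definition qcommutator (R : realType) (n : nat) (q : R) (A B : 'M[R[i]]_n) :
    'M[R[i]]_n :=
  A *m B - q%:C *: (B *m A).

Definition qcomm_form (R : realType) (n : nat) (A B : 'M[R[i]]_n) (q : R) : R :=
  complex.Re (hs_inner (commutator B A) (qcommutator q B A)).

Definition qcomm_bound (R : realType) (q : R) : R :=
  ((1 + q) + Num.sqrt (2 * (1 + q ^+ 2))) / 2.

Local Lemma Re_trace_form (C : numClosedFieldType) (n : nat) (A B : 'M[C]_n)
    (q : C) : q \is Num.real ->
  'Re (\tr ((B *m A - A *m B) ^t* *m (B *m A - q *: (A *m B)))) =
    \tr (A ^t* *m B ^t* *m B *m A + q *: (B ^t* *m A ^t* *m A *m B)
         - ((1 + q) / 2) *: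
             (A ^t* *m B ^t* *m A *m B + B ^t* *m A ^t* *m B *m A)).
Proof.
move=> /CrealP qJ.
have trJ (M : 'M[C]_n) : \tr (M ^t* ) = ((\tr M)^*)%R.
  by rewrite /mxtrace rmorph_sum; apply: eq_bigr => i _; rewrite !mxE.
have mulJ (M N : 'M[C]_n) : (M *m N) ^t* = N ^t* *m M ^t*.
  by rewrite trmx_mul map_mxM.
have subJ (M N : 'M[C]_n) : (M - N) ^t* = M ^t* - N ^t*.
  by apply/matrixP => i j; rewrite !mxE rmorphB.
have tr4J (M N P Q : 'M[C]_n) :
    ((\tr (M *m N *m P *m Q))^*)%R = \tr (Q ^t* *m P ^t* *m N ^t* *m M ^t* ).
  by rewrite -trJ !mulJ !mulmxA.
have := tr4J (B ^t* ) (A ^t* ) A B; have := tr4J (B ^t* ) (A ^t* ) B A.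
have := tr4J (A ^t* ) (B ^t* ) A B; have := tr4J (A ^t* ) (B ^t* ) B A.
rewrite !trmxCK ReE subJ !mulJ mulmxBl !mulmxBr -!scalemxAr !mulmxA.
have trB (M N : 'M[C]_n) : \tr (M - N) = \tr M - \tr N by rewrite raddfB.
rewrite !trB mxtraceD !mxtraceZ mxtraceD.
move: (\tr (A ^t* *m B ^t* *m B *m A)) (\tr (A ^t* *m B ^t* *m A *m B))
  (\tr (B ^t* *m A ^t* *m B *m A)) (\tr (B ^t* *m A ^t* *m A *m B)).
move=> X Z W Y XJ ZJ WJ YJ.
rewrite !(rmorphB, rmorphM) /= qJ XJ YJ ZJ WJ.
by field.
Qed.

Lemma qcomm_form_trace (R : realType) (n : nat) (A B : 'M[R[i]]_n) (q : R) :
  (qcomm_form A B q)%:C =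
    \tr (A ^t* *m B ^t* *m B *m A + q%:C *: (B ^t* *m A ^t* *m A *m B)
         - ((1 + q) / 2)%:C *:
             (A ^t* *m B ^t* *m A *m B + B ^t* *m A ^t* *m B *m A)).
Proof.
rewrite complexRe Re_trace_form; last by apply/complex_realP; exists q.
by rewrite rmorphM fmorphV rmorphD rmorph1 rmorph_nat.
Qed.

(* Main.v *)
(* Put X = AB and Y = BA, so that f(A,B;q) = Re <Y - X, Y - qX>.  Entrywise this
   is the real quadratic form (y - x)(y - qx), whose largest eigenvalue is c(q);
   hence f <= c(q) (|X|^2 + |Y|^2).

   If A is normal, take A = diag(d): then x = d_i b_ij and y = d_j b_ij, the
   diagonal entries contribute nothing, and the others satisfy
   |x|^2 + |y|^2 <= |A|^2 |b_ij|^2.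

   If n = 2, then f does not change when a common scalar matrix is subtracted
   from X and Y, since tr(Y - X) = 0.  Removing the traces leaves
   |X|^2 + |Y|^2 - |tr X|^2, which is at most |A|^2 |B|^2 because the difference
   is |conj(tr A) tr B - tr(A^* B)|^2.

   Equality holds for A = diag(x, y, 0, ..., 0) and B = E_12, where (x, y) is an
   eigenvector of the quadratic form for c(q). *)

Require Import Defs.
From mathcomp Require Import ring lra.
Set Implicit Arguments.
Unset Strict Implicit.
Unset Printing Implicit Defensive.
Import Order.TTheory GRing.Theory Num.Theory.
Local Open Scope ring_scope.
Local Open Scope complex_scope.
Local Open Scope sesquilinear_scope.

(** * The constant c(q) and the scalar quadratic form *)

Section BoundConstant.
Variables (R : realType) (q : R).
Let c := qcomm_bound q.

(** The square root dominates |1 + q|, since 2(1 + q^2) - (1 + q)^2 = (1 - q)^2. *)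
Lemma qcomm_bound_ge0 : 0 <= c.
Proof.
have : `|1 + q| <= Num.sqrt (2 * (1 + q ^+ 2)).
  by rewrite -sqrtr_sqr ler_wsqrtr //; have := sqr_ge0 (1 - q); nra.
rewrite /c /qcomm_bound ler_norml => /andP[+ _].
set s := Num.sqrt _; lra.
Qed.

(** Amounts to q - 1 < s with s the square root in [c]. This is clear if q < 1; otherwise s^2 - (1 -
    q)^2 = (1 + q)^2 > 0. Strictness allows cancelling [c - q] below. *)
Lemma qcomm_bound_gt : q < c.
Proof.
have lt : `|1 - q| < Num.sqrt (2 * (1 + q ^+ 2)) \/ 0 < 1 - q.
  have [|lt1q] := ltP 0 (1 - q); first by right.
  left; rewrite -sqrtr_sqr ltr_sqrt; nra.
case: lt => [|lt1q].
  rewrite ltr_norml /c /qcomm_bound => /andP[+ _].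
  set s := Num.sqrt _; lra.
have := sqrtr_ge0 (2 * (1 + q ^+ 2)).
rewrite /c /qcomm_bound; set s := Num.sqrt _; lra.
Qed.

(* [c] is an eigenvalue of the quadratic form [(y - x) * (y - q * x)]. *)
Lemma qcomm_bound_charpoly : (c - q) * (c - 1) = ((1 + q) / 2) ^+ 2.
Proof.
have sE : Num.sqrt (2 * (1 + q ^+ 2)) ^+ 2 = 2 * (1 + q ^+ 2).
  by rewrite sqr_sqrtr //; have := sqr_ge0 q; lra.
rewrite /c /qcomm_bound; move: sE; set s := Num.sqrt _ => sE.
suff -> : ((1 + q + s) / 2 - q) * ((1 + q + s) / 2 - 1)
   = (s ^+ 2 - (1 - q) ^+ 2) / 4 by rewrite sE; field.
by field.
Qed.

(** Completing the square: the gap is (c - q)x^2 + (1 + q)xy + (c - 1)y^2, whose discriminant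
    vanishes by [qcomm_bound_charpoly]. *)
Lemma real_qform_gap (x y : R) :
  (c - q) * (c * (x ^+ 2 + y ^+ 2) - (y - x) * (y - q * x)) =
  ((c - q) * x + (1 + q) / 2 * y) ^+ 2.
Proof.
rewrite sqrrD exprMn [(_ / 2 * y) ^+ 2]exprMn -qcomm_bound_charpoly.
by field.
Qed.

Lemma real_qform_le (x y : R) :
  (y - x) * (y - q * x) <= c * (x ^+ 2 + y ^+ 2).
Proof.
rewrite -subr_ge0 -(pmulr_rge0 _ (_ : 0 < c - q)) ?subr_gt0 ?qcomm_bound_gt //.
by rewrite real_qform_gap sqr_ge0.
Qed.

(** This vector is a zero of the linear form squared in [real_qform_gap]. *)
Lemma real_qform_eigenvector (x y : R) : x = - ((1 + q) / 2) -> y = c - q ->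
  (y - x) * (y - q * x) = c * (x ^+ 2 + y ^+ 2).
Proof.
move=> xE yE; apply/esym/eqP; rewrite -subr_eq0.
have: c - q != 0 by rewrite gt_eqF // subr_gt0 qcomm_bound_gt.
move=> /mulfI/inj_eq <-; rewrite real_qform_gap mulr0 xE yE.
by rewrite mulrN mulrC addNr expr0n.
Qed.

Definition qform (x y : R[i]) : R :=
  complex.Re ((y - x)^*%C * (y - q%:C * x)).

Definition sqabs (x : R[i]) : R := complex.Re (x^*%C * x).

Lemma sqabsE x : sqabs x = complex.Re x ^+ 2 + complex.Im x ^+ 2.
Proof. by rewrite /sqabs; case: x => a b /=; ring. Qed.

Lemma sqabs_ge0 x : 0 <= sqabs x.
Proof. by rewrite sqabsE addr_ge0 ?sqr_ge0. Qed.

Lemma sqabsM x y : sqabs (x * y) = sqabs x * sqabs y.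
Proof. by rewrite !sqabsE; case: x y => [a b] [u v] /=; ring. Qed.

(** As q is real, [qform] is the sum of the real form at the real parts and at the imaginary
    parts. *)
Lemma qform_le x y : qform x y <= c * (sqabs x + sqabs y).
Proof.
have := (real_qform_le (complex.Re x) (complex.Re y),
         real_qform_le (complex.Im x) (complex.Im y)).
rewrite !sqabsE /qform; case: x y => [a b] [u v] /= [].
move=> h1 h2; have := lerD h1 h2.
by congr (_ <= _); ring.
Qed.

Lemma qform_id x : qform x x = 0.
Proof. by rewrite /qform subrr conjc0 mul0r. Qed.

End BoundConstant.

(** * Entrywise formulas for the norm and the form *)

Section MatrixForm.
Variable R : realType.

Lemma Re_sum (I : finType) (F : I -> R[i]) :
  complex.Re (\sum_i F i) = \sum_i complex.Re (F i).
Proof. by apply: (big_morph (@complex.Re R)) => // -[a b] [u v]. Qed.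

Definition sqnorm n (A : 'M[R[i]]_n) : R := complex.Re (hs_inner A A).

Lemma hs_innerE n (A B : 'M[R[i]]_n) :
  hs_inner A B = \sum_j \sum_i (A i j)^*%C * B i j.
Proof.
apply: eq_bigr => j _; rewrite mxE; apply: eq_bigr => i _.
by rewrite !mxE.
Qed.

Lemma sqnormE n (A : 'M[R[i]]_n) : sqnorm A = \sum_j \sum_i sqabs (A i j).
Proof.
rewrite /sqnorm hs_innerE Re_sum.
by apply: eq_bigr => j _; rewrite Re_sum.
Qed.

Lemma frob_norm_sqr n (A : 'M[R[i]]_n) : frob_norm A ^+ 2 = sqnorm A.
Proof.
rewrite sqr_sqrtr // -/(hs_inner A A) -/(sqnorm A) sqnormE.
by do 2![apply: sumr_ge0 => ? _]; apply: sqabs_ge0.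
Qed.

(** Detaches f from the factors A and B, so that the two products can be shifted freely. *)
Definition pair_form n q (X Y : 'M[R[i]]_n) : R :=
  complex.Re (hs_inner (Y - X) (Y - q%:C *: X)).

Lemma qcomm_formE n (A B : 'M[R[i]]_n) q :
  qcomm_form A B q = pair_form q (A *m B) (B *m A).
Proof. by []. Qed.

Lemma pair_formE n q (X Y : 'M[R[i]]_n) :
  pair_form q X Y = \sum_j \sum_i qform q (X i j) (Y i j).
Proof.
rewrite /pair_form hs_innerE Re_sum; apply: eq_bigr => j _.
by rewrite Re_sum; apply: eq_bigr => i _; rewrite !mxE.
Qed.

Lemma pair_form_le n q (X Y : 'M[R[i]]_n) :
  pair_form q X Y <= qcomm_bound q * (sqnorm X + sqnorm Y).
Proof.
rewrite pair_formE !sqnormE -big_split mulr_sumr; apply: ler_sum => j _.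
rewrite -big_split mulr_sumr; apply: ler_sum => i _.
exact: qform_le.
Qed.

(** * Two-by-two matrices *)

Lemma pair_form_shift n q (X Y : 'M[R[i]]_n) (t : R[i]) :
  \tr X = \tr Y -> pair_form q (X - t%:M) (Y - t%:M) = pair_form q X Y.
Proof.
move=> trXY; rewrite /pair_form /hs_inner.
have -> : Y - t%:M - (X - t%:M) = Y - X by rewrite opprB addrA subrK.
have -> : Y - t%:M - q%:C *: (X - t%:M) =
          Y - q%:C *: X + (q%:C * t - t)%:M.
  by apply/matrixP => i j; rewrite !mxE; case: (i == j) => /=; ring.
rewrite mulmxDr mxtraceD mul_mx_scalar mxtraceZ.
(* The extra term pairs [Y - X] with a scalar matrix, hence is a multiple of the conjugate of tr(Y -
   X). *)
have -> : \tr ((Y - X) ^t* ) = 0; last by rewrite mulr0 addr0.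
rewrite -map_trmx mxtrace_tr trace_map_mx raddfB /= trXY subrr.
exact: conjc0.
Qed.

(** A polynomial identity in the eight entries and their conjugates, taken as independent variables.
    Its last term, a squared modulus, is the slack in the bound. *)
Lemma products_identity (A B : 'M[R[i]]_2) :
  hs_inner A A * hs_inner B B =
    hs_inner (A *m B) (A *m B) + hs_inner (B *m A) (B *m A)
    - (\tr (A *m B))^*%C * \tr (A *m B)
    + ((\tr A)^*%C * \tr B - hs_inner A B)^*%C
      * ((\tr A)^*%C * \tr B - hs_inner A B).
Proof.
rewrite !hs_innerE /mxtrace !(big_ord_recr, big_ord0) /= !mxE.
rewrite !(big_ord_recr, big_ord0) /= !add0r.
move: (A _ _) (A _ _) (A _ _) (A _ _) (B _ _) (B _ _) (B _ _) (B _ _).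
move=> a00 a10 a01 a11 b00 b10 b01 b11.
rewrite !(rmorphB, rmorphD, rmorphM) /= !conjcK.
ring.
Qed.

(** Pythagoras: [t%:M] is the orthogonal projection of X onto the scalar matrices. *)
Lemma hs_inner_traceless (X : 'M[R[i]]_2) :
  let t := \tr X / 2 in
  hs_inner (X - t%:M) (X - t%:M) = hs_inner X X - (\tr X)^*%C * \tr X / 2.
Proof.
rewrite /= !hs_innerE /mxtrace !(big_ord_recr, big_ord0) /= !mxE /= !add0r.
move: (X _ _) (X _ _) (X _ _) (X _ _) => a b c d.
rewrite ?mulr1n ?mulr0n ?subr0.
rewrite !(fmorphV, rmorph_nat, rmorphB, rmorphD, rmorphM) /=.
by field.
Qed.

Lemma sqnorm_ge0 n (A : 'M[R[i]]_n) : 0 <= sqnorm A.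
Proof. by rewrite -frob_norm_sqr sqr_ge0. Qed.

Lemma hs_inner_real n (A : 'M[R[i]]_n) : hs_inner A A = (sqnorm A)%:C.
Proof.
rewrite sqnormE hs_innerE raddf_sum /=; apply: eq_bigr => j _.
rewrite raddf_sum /=; apply: eq_bigr => i _.
by rewrite /sqabs; case: (A i j) => a b; simpc; congr (_ +i* _); ring.
Qed.

(** AB and BA have equal traces, so removing their scalar parts costs |tr(AB)|^2 / 2 twice, which is
    the negative term of [products_identity]. *)
Lemma traceless_products_le (A B : 'M[R[i]]_2) :
  let t := \tr (A *m B) / 2 in
  sqnorm (A *m B - t%:M) + sqnorm (B *m A - t%:M) <= sqnorm A * sqnorm B.
Proof.
have := products_identity A B.
have := hs_inner_traceless (B *m A); rewrite -mxtrace_mulC /=.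
have := hs_inner_traceless (A *m B); rewrite /=.
set X := A *m B - _; set Y := B *m A - _; set z := _ - hs_inner A B.
set w := _^*%C * \tr _ => EX EY EN.
have {EX EY}EN : hs_inner A A * hs_inner B B =
    hs_inner X X + hs_inner Y Y + z^*%C * z by rewrite EN EX EY; field.
have -> : sqnorm A * sqnorm B = sqnorm X + sqnorm Y + sqabs z.
  move: EN; rewrite !hs_inner_real -rmorphM => /(congr1 (@complex.Re R)) /= ->.
  by rewrite /sqabs; case: (_ * z).
by rewrite lerDl sqabs_ge0.
Qed.

Lemma qcomm_form_dim2_le q (A B : 'M[R[i]]_2) :
  qcomm_form A B q <= qcomm_bound q * sqnorm A * sqnorm B.
Proof.
rewrite qcomm_formE -(pair_form_shift q (\tr (A *m B) / 2) (mxtrace_mulC A B)).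
apply: le_trans (pair_form_le _ _ _) _.
rewrite -mulrA ler_wpM2l ?qcomm_bound_ge0 //; exact: traceless_products_le.
Qed.

(** * Unitary invariance and normal matrices *)

Lemma hs_inner_unitary n (P M N : 'M[R[i]]_n) : P \is unitarymx ->
  hs_inner (invmx P *m M *m P) (invmx P *m N *m P) = hs_inner M N.
Proof.
move=> Pu; rewrite /hs_inner invmx_unitary // !trmx_mul !map_mxM trmxCK.
by rewrite !mulmxA (mulmxtVK _ Pu) mxtrace_mulC !mulmxA (unitarymxP Pu) mul1mx.
Qed.

Lemma sqnorm_unitary n (P M : 'M[R[i]]_n) : P \is unitarymx ->
  sqnorm (invmx P *m M *m P) = sqnorm M.
Proof. by move=> Pu; rewrite /sqnorm hs_inner_unitary. Qed.

(** Conjugation by P respects products and linear combinations and preserves the inner product. *)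
Lemma qcomm_form_unitary n q (P A B : 'M[R[i]]_n) : P \is unitarymx ->
  qcomm_form (invmx P *m A *m P) (invmx P *m B *m P) q = qcomm_form A B q.
Proof.
move=> Pu; rewrite !qcomm_formE /pair_form.
have := mulmxV (unitarymx_unit Pu).
have := fun M N => congr1 (@complex.Re R) (hs_inner_unitary M N Pu).
move: (invmx P) => Q hsP PQ.
have conjM (M N : 'M[R[i]]_n) :
    Q *m M *m P *m (Q *m N *m P) = Q *m (M *m N) *m P.
  by rewrite !mulmxA -(mulmxA _ P Q) PQ mulmx1.
rewrite -[RHS]hsP !conjM; congr (complex.Re (hs_inner _ _)).
  by rewrite mulmxBr mulmxBl.
by rewrite mulmxBr mulmxBl -scalemxAr -scalemxAl.
Qed.

Lemma qcomm_form_diag n q (d : 'rV[R[i]]_n) (B : 'M[R[i]]_n) :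
  qcomm_form (diag_mx d) B q =
  \sum_j \sum_i qform q (d 0 i * B i j) (B i j * d 0 j).
Proof.
by rewrite qcomm_formE pair_formE mul_diag_mx mul_mx_diag;
  do 2![apply: eq_bigr => ? _]; rewrite !mxE.
Qed.

Lemma sqnorm_diag n (d : 'rV[R[i]]_n) :
  sqnorm (diag_mx d) = \sum_i sqabs (d 0 i).
Proof.
rewrite sqnormE; apply: eq_bigr => j _.
rewrite (bigD1 j) //= big1 ?addr0 => [|i /negPf ij]; first by rewrite mxE eqxx.
by rewrite mxE ij sqabsE /= expr0n addr0.
Qed.

Lemma qcomm_form_diag_le n q (d : 'rV[R[i]]_n) (B : 'M[R[i]]_n) :
  qcomm_form (diag_mx d) B q <=
  qcomm_bound q * sqnorm (diag_mx d) * sqnorm B.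
Proof.
rewrite qcomm_form_diag [sqnorm B]sqnormE mulr_sumr; apply: ler_sum => j _.
rewrite mulr_sumr; apply: ler_sum => i _.
have [->|ij] := eqVneq i j.
  rewrite [_ * d 0 j]mulrC qform_id.
  apply: mulr_ge0 (sqabs_ge0 _).
  exact: mulr_ge0 (qcomm_bound_ge0 _) (sqnorm_ge0 _).
apply: le_trans (qform_le _ _ _) _.
rewrite !sqabsM [_ * sqabs (B i j)]mulrC -mulrDr mulrCA mulrC.
rewrite ler_wpM2r ?sqabs_ge0 // ler_wpM2l ?qcomm_bound_ge0 // sqnorm_diag.
(* As i and j differ, |d_i|^2 and |d_j|^2 are two separate terms of the sum for |A|^2. *)
rewrite (bigD1 i) //= (bigD1 j) 1?eq_sym //= addrA lerDl.
by apply: sumr_ge0 => k _; apply: sqabs_ge0.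
Qed.

Lemma qcomm_form_normal_le n q (A B : 'M[R[i]]_n) : A \is normalmx ->
  qcomm_form A B q <= qcomm_bound q * sqnorm A * sqnorm B.
Proof.
move=> /orthomx_spectralP; set P := spectralmx A; set d := spectral_diag A.
move=> eqA; have Pu : P \is unitarymx by apply: spectral_unitarymx.
(* B is expressed in the eigenbasis of A, so that one conjugation by P serves both matrices. *)
have eqB : B = invmx P *m (P *m B *m invmx P) *m P.
  by rewrite !mulmxA mulmxKV ?unitarymx_unit // mulVmx ?unitarymx_unit ?mul1mx.
have := qcomm_form_diag_le q d (P *m B *m invmx P).
rewrite -(qcomm_form_unitary _ _ _ Pu) -(sqnorm_unitary (diag_mx d) Pu).
by rewrite -(sqnorm_unitary (P *m B *m invmx P) Pu) -eqA -eqB.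
Qed.

(** * Sharpness *)

Lemma sqnorm_delta n (i j : 'I_n) : sqnorm (delta_mx i j : 'M[R[i]]_n) = 1.
Proof.
rewrite sqnormE (bigD1 j) //= (bigD1 i) //= mxE !eqxx sqabsE /=.
rewrite !big1 => [|k /negPf kj|k /negPf ki].
- by rewrite expr1n expr0n !addr0.
- by apply: big1 => k' _; rewrite mxE kj andbF sqabsE /= expr0n addr0.
- by rewrite mxE ki sqabsE /= expr0n addr0.
Qed.

Lemma qcomm_form_diag_delta n q (d : 'rV[R[i]]_n) (i j : 'I_n) :
  qcomm_form (diag_mx d) (delta_mx i j) q = qform q (d 0 i) (d 0 j).
Proof.
rewrite qcomm_form_diag (bigD1 j) //= (bigD1 i) //= !mxE !eqxx mulr1 mul1r.
rewrite !big1 ?addr0 // => [k /negPf kj|k /negPf ki].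
- by apply: big1 => k' _; rewrite !mxE kj andbF mulr0 mul0r qform_id.
- by rewrite mxE ki mulr0 mul0r qform_id.
Qed.

Lemma qcomm_form_sharp n q : (1 < n)%N ->
  exists A B : 'M[R[i]]_n,
    [/\ A != 0, B != 0, A \is normalmx &
        qcomm_form A B q = qcomm_bound q * sqnorm A * sqnorm B].
Proof.
move=> n1; pose i := Ordinal (ltnW n1); pose j := Ordinal n1.
have ji : (j == i) = false by [].
set c := qcomm_bound q.
(* The nonzero entries of [d] form the eigenvector for [c] of the 2x2 form. *)
pose d : 'rV[R[i]]_n := \row_k
  if k == i then (- ((1 + q) / 2))%:C else if k == j then (c - q)%:C else 0.
have di : d 0 i = (- ((1 + q) / 2))%:C by rewrite mxE eqxx.
have dj : d 0 j = (c - q)%:C by rewrite mxE ji eqxx.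
have cq : 0 < c - q by rewrite subr_gt0 qcomm_bound_gt.
exists (diag_mx d), (delta_mx i j); split.
(* The entry at j is c - q > 0, whereas the one at i vanishes for q = -1. *)
- apply/eqP => /matrixP/(_ j j); rewrite !mxE eqxx ji mulr1n => -[] /eqP.
  by rewrite gt_eqF.
- by apply/eqP => /matrixP/(_ i j)/eqP; rewrite !mxE !eqxx oner_eq0.
- by apply/normalmxP; rewrite tr_diag_mx map_diag_mx diag_mxC.
rewrite qcomm_form_diag_delta sqnorm_delta mulr1 sqnorm_diag.
rewrite (bigD1 i) //= (bigD1 j) ?ji //= big1 => [|k /andP[/negPf ki /negPf kj]].
  rewrite di dj !sqabsE /qform /= !expr0n /= !addr0.
  rewrite -(real_qform_eigenvector erefl erefl).
  by rewrite -/c; ring.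
by rewrite mxE ki kj sqabsE /= expr0n addr0.
Qed.

End MatrixForm.

Theorem theorem1 (R : realType) (q : R) (n : nat) :
  (forall A B : 'M[R[i]]_n,
     A \is normalmx \/ n = 2%N ->
     qcomm_form A B q <= qcomm_bound q * frob_norm A ^+ 2 * frob_norm B ^+ 2)
  /\
  ((1 < n)%N ->
   exists A B : 'M[R[i]]_n,
     [/\ A != 0, B != 0, A \is normalmx &
         qcomm_form A B q
           = qcomm_bound q * frob_norm A ^+ 2 * frob_norm B ^+ 2]).
Proof.
split=> [A B|n1].
  rewrite !frob_norm_sqr => -[|n2]; first exact: qcomm_form_normal_le.
  by subst n; apply: qcomm_form_dim2_le.
have [A [B [A0 B0 An AB]]] := qcomm_form_sharp q n1.
by exists A, B; rewrite !frob_norm_sqr.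
Qed.
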